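(* Let $K$ be a field, let $X=(X_{ij})$ be the $3\times 3$ matrix of variables of the polynomial ring $K[X_{3\times 3}]$, let $\Delta=\det X$, let $\mathcal{M}_2$ be the set of $2$-minors of $X$, and let $A_2(3,3)=K[\mathcal{M}_2]$ be the $K$-subalgebra of $K[X_{3\times 3}]$ generated by $\mathcal{M}_2$. Then the set $$\mathcal{U}=\mathcal{M}_2\cup\{X_{ij}\Delta : i,j\in\{1,2,3\}\}$$ is a universal Sagbi basis of $A_2(3,3)$. More precisely, for every monomial order on $K[X_{3\times 3}]$, a Sagbi basis of $A_2(3,3)$ is obtained by adding to $\mathcal{M}_2$ at most three elements of the form $X_{ij}\Delta$.
   Context: Given a polynomial ring $R$ over $K$ with a monomial order and a $K$-subalgebra $A\subset R$, the initial algebra $\operatorname{in}(A)$ is the $K$-subalgebra of $R$ which, as a $K$-vector space, is spanned by the initial monomials of the nonzero elements of $A$. A subset $\mathcal{F}\subset A$ is a Sagbi basis of $A$ with respect to the given order if the initial monomials $\operatorname{in}(f)$, $f\in\mathcal{F}$, generate $\operatorname{in}(A)$ as a $K$-algebra. A universal Sagbi basis of $A$ is a subset of $A$ that is a Sagbi basis of $A$ with respect to every monomial order on $R$. *)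

(* Defs.v *)
From HB Require Import structures.
From mathcomp Require Import all_boot all_order all_algebra.
From mathcomp Require Import mpoly.

Set Implicit Arguments.
Unset Strict Implicit.
Unset Printing Implicit Defensive.

Import GRing.Theory.
Local Open Scope ring_scope.

(* Subsets of a polynomial ring are Prop-valued predicates: membership in a
   generated subalgebra has no evident boolean decision procedure. *)

Inductive alg_gen (K : fieldType) (n : nat) (S : {mpoly K[n]} -> Prop) :
    {mpoly K[n]} -> Prop :=
| alg_gen_in p : S p -> alg_gen S p
| alg_gen_one : alg_gen S 1
| alg_gen_add p q : alg_gen S p -> alg_gen S q -> alg_gen S (p + q)
| alg_gen_mul p q : alg_gen S p -> alg_gen S q -> alg_gen S (p * q)
| alg_gen_scale (c : K) p : alg_gen S p -> alg_gen S (c *: p).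

Inductive lin_span (K : fieldType) (n : nat) (S : {mpoly K[n]} -> Prop) :
    {mpoly K[n]} -> Prop :=
| lin_span_in p : S p -> lin_span S p
| lin_span_zero : lin_span S 0
| lin_span_add p q : lin_span S p -> lin_span S q -> lin_span S (p + q)
| lin_span_scale (c : K) p : lin_span S p -> lin_span S (c *: p).

(* Multinomials in 'X_{1..n} are the exponent vectors of monomials, written
   additively: 0%MM is the monomial 1 and (m1 + m2)%MM the product. *)
Record monomial_order (n : nat) (le : rel 'X_{1..n}) : Prop := MonomialOrder {
  mo_anti : antisymmetric le;
  mo_trans : transitive le;
  mo_total : total le;
  mo_min : forall m : 'X_{1..n}, le 0%MM m;
  mo_add : forall m m1 m2 : 'X_{1..n},
    le m1 m2 -> le (m1 + m)%MM (m2 + m)%MM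
}.

(* The le-largest monomial of the support.  The starting value 0%MM is
   le-minimal, so it is harmless when p != 0; it is a junk value for p = 0. *)
Definition in_mon (K : fieldType) (n : nat) (le : rel 'X_{1..n})
    (p : {mpoly K[n]}) : 'X_{1..n} :=
  \big[(fun m1 m2 => if le m1 m2 then m2 else m1) / 0%MM]_(m <- msupp p) m.

Definition in_mons (K : fieldType) (n : nat) (le : rel 'X_{1..n})
    (F : {mpoly K[n]} -> Prop) (q : {mpoly K[n]}) : Prop :=
  exists f : {mpoly K[n]}, [/\ F f, f != 0 & q = 'X_[in_mon le f]].

Definition in_alg (K : fieldType) (n : nat) (le : rel 'X_{1..n})
    (A : {mpoly K[n]} -> Prop) : {mpoly K[n]} -> Prop :=
  lin_span (in_mons le A).

Definition sagbi_basis (K : fieldType) (n : nat) (le : rel 'X_{1..n})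
    (A F : {mpoly K[n]} -> Prop) : Prop :=
  (forall f, F f -> A f) /\
  (forall p, alg_gen (in_mons le F) p <-> in_alg le A p).

Definition universal_sagbi_basis (K : fieldType) (n : nat)
    (A F : {mpoly K[n]} -> Prop) : Prop :=
  forall le : rel 'X_{1..n}, monomial_order le -> sagbi_basis le A F.

(* The variable X_ij is the one whose index is the position of (i, j) in the
   row-major enumeration of the entries. *)
Definition gen_mx (K : fieldType) (r s : nat) : 'M[{mpoly K[r * s]}]_(r, s) :=
  \matrix_(i, j) 'X_(mxvec_index i j).

Definition is_minor (K : fieldType) (n t r s : nat)
    (X : 'M[{mpoly K[n]}]_(r, s)) (p : {mpoly K[n]}) : Prop :=
  exists (f : 'I_t -> 'I_r) (g : 'I_t -> 'I_s),
    [/\ {homo f : a b / (a < b)%N}, {homo g : a b / (a < b)%N}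
      & p = \det (mxsub f g X)].

Definition minors (K : fieldType) (t r s : nat) : {mpoly K[r * s]} -> Prop :=
  is_minor t (gen_mx K r s).
Arguments minors K t r s : clear implicits.

Definition minor_alg (K : fieldType) (t r s : nat) : {mpoly K[r * s]} -> Prop :=
  alg_gen (minors K t r s).
Arguments minor_alg K t r s : clear implicits.

Definition minors_adjoin (K : fieldType) (E : {set 'I_3 * 'I_3})
    (p : {mpoly K[3 * 3]}) : Prop :=
  minors K 2 3 3 p \/
  exists2 e, e \in E & p = gen_mx K 3 3 e.1 e.2 * \det (gen_mx K 3 3).
Arguments minors_adjoin K E : clear implicits.

(* Main.v *)
Require Import Defs.
From HB Require Import structures.
From mathcomp Require Import all_boot all_order all_algebra.
From mathcomp Require Import fingroup perm.
From mathcomp Require Import mpoly.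
From mathcomp Require Import ring zify.

Set Implicit Arguments.
Unset Strict Implicit.
Unset Printing Implicit Defensive.

Import GRing.Theory.
Local Open Scope ring_scope.

(* Two 2-minors of the cofactor matrix Y of X multiply to
   Y_jj Y_kk = Y_jk Y_kj + X_ii det X  ({i, j, k} = {1, 2, 3}).
   Permute the columns so that the diagonal carries the smallest monomial of
   det X.  The two products of cofactors have the same initial monomial exactly
   when X_ii divides no initial monomial of a 2-minor; call such an i nonleading.
   To an exponent a in N^9 attach the product of the Y_kl^(a_kl), in which, for
   every nonleading i, as many factors Y_jk Y_kj as possible are traded for
   X_ii det X.  These products have pairwise distinct initial monomials: the
   exponent of X_ii counts the trades, and what remains is a linear system over
   N.  In each degree bound there are as many of them as monomials in the Y_kl,
   so they form a basis of K[M_2], and every initial monomial of K[M_2] is the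
   initial monomial of one of them.  At most three X_ii det X are involved. *)

(** * Leading monomials under a monomial order *)

Section LeadingMonomial.

Variables (n : nat) (le : rel 'X_{1..n}).
Hypothesis leP : monomial_order le.

Let le_anti := mo_anti leP.
Let le_trans := mo_trans leP.
Let le_total := mo_total leP.

Lemma mo_refl m : le m m.
Proof. by have := le_total m m; rewrite orbb. Qed.

Lemma mo_addl m m1 m2 : le m1 m2 -> le (m + m1)%MM (m + m2)%MM.
Proof. by rewrite !(addmC m); apply: mo_add. Qed.

Lemma mo_addD m1 m2 p1 p2 : le m1 p1 -> le m2 p2 -> le (m1 + m2)%MM (p1 + p2)%MM.
Proof.
by move=> h1 h2; apply: le_trans (mo_addl _ h2); apply: mo_add.
Qed.

Lemma mo_addIr m m1 m2 : le (m1 + m)%MM (m2 + m)%MM -> le m1 m2.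
Proof.
move=> h; case/orP: (le_total m1 m2) => [//|/(mo_add leP m) h'].
have /addIm -> : (m1 + m = m2 + m)%MM by apply: le_anti; rewrite h.
exact: mo_refl.
Qed.

(** The order cancels: replacing [m2] by [p2] gives [p1 + m2 <= p1 + p2 = m1 + m2], hence
    [p1 <= m1]. This makes the top term of a product unique. *)
Lemma mo_addE m1 m2 p1 p2 : le m1 p1 -> le m2 p2 ->
  (m1 + m2 = p1 + p2)%MM -> m1 = p1 /\ m2 = p2.
Proof.
move=> h1 h2 e; have e1 : m1 = p1.
  apply: le_anti; rewrite h1 /=; apply: (@mo_addIr m2).
  by rewrite e; apply: mo_addl.
by split=> //; move: e; rewrite e1 => /addmI.
Qed.

Definition mo_max m1 m2 := if le m1 m2 then m2 else m1.

Lemma mo_max_l m1 m2 : le m1 (mo_max m1 m2).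
Proof. by rewrite /mo_max; case: ifP => // _; apply: mo_refl. Qed.

Lemma mo_max_r m1 m2 : le m2 (mo_max m1 m2).
Proof.
rewrite /mo_max; case: ifP => [_|h]; first exact: mo_refl.
by have := le_total m1 m2; rewrite h.
Qed.

Lemma mo_bigmax (s : seq 'X_{1..n}) :
  let M := \big[mo_max / 0%MM]_(m <- s) m in
  (forall m, m \in s -> le m M) /\ (s != [::] -> M \in s).
Proof.
elim: s => [|m s [ih1 ih2]] //=; rewrite big_cons; split=> [m'|_].
  rewrite inE => /predU1P[->|/ih1 h]; first exact: mo_max_l.
  exact: le_trans h (mo_max_r _ _).
rewrite {1}/mo_max; case: ifP => h; last exact: mem_head.
(* With an empty tail the running maximum is the default [0]; then [m <= 0] forces [m = 0], so the
   value is still a member. *)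
case: s ih1 ih2 h => [|m1 s] _ ih2; last by rewrite inE ih2 ?orbT.
rewrite big_nil inE => h; apply/eqP.
by apply: le_anti; rewrite h mo_min.
Qed.

Variable K : fieldType.
Implicit Types p q : {mpoly K[n]}.

(** A relational form of [in_mon]: it rules out [p = 0], so the default value of [in_mon] never
    interferes. *)
Definition lead p m := p@_m != 0 /\ forall m', p@_m' != 0 -> le m' m.

Lemma lead_uniq p m1 m2 : lead p m1 -> lead p m2 -> m1 = m2.
Proof. by move=> [h1 l1] [h2 l2]; apply: le_anti; rewrite l1 ?l2. Qed.

Lemma lead_neq0 p m : lead p m -> p != 0.
Proof. by case=> h _; apply: contraNneq h => ->; rewrite mcoeff0. Qed.

Lemma lead_in_mon p : p != 0 -> lead p (in_mon le p).
Proof.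
move=> p0; have [h1 h2] := mo_bigmax (msupp p).
split=> [|m']; rewrite -mcoeff_msupp; last exact: h1.
by apply: h2; rewrite msupp_eq0.
Qed.

Lemma in_monE p m : lead p m -> in_mon le p = m.
Proof. by move=> h; exact: lead_uniq (lead_in_mon (lead_neq0 h)) h. Qed.

Lemma leadX m : lead 'X_[m] m.
Proof.
split=> [|m']; rewrite mcoeffX; first by rewrite eqxx oner_neq0.
by case: (m =P m') => [->|_]; rewrite ?eqxx // => _; apply: mo_refl.
Qed.

Lemma leadN p m : lead p m -> lead (- p) m.
Proof.
by case=> h l; split=> [|m']; rewrite mcoeffN oppr_eq0 //; apply: l.
Qed.

(** By [mo_addE] only the pair [(m1, m2)] contributes to the coefficient at [m1 + m2], and a field
    has no zero divisors. *)
Lemma leadM p q m1 m2 : lead p m1 -> lead q m2 -> lead (p * q) (m1 + m2)%MM.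
Proof.
move=> [p1 l1] [q2 l2]; split=> [|m']; last first.
  rewrite -mcoeff_msupp => /msuppM_le/allpairsP[[a b] /= [ha hb ->]].
  by apply: mo_addD; [apply: l1|apply: l2]; rewrite -mcoeff_msupp.
have b1 : (mdeg m1 < (mdeg (m1 + m2)).+1)%N by rewrite ltnS mdegD leq_addr.
have b2 : (mdeg m2 < (mdeg (m1 + m2)).+1)%N by rewrite ltnS mdegD leq_addl.
rewrite mcoeffM (bigD1 (BMultinom b1, BMultinom b2)) //= big1 ?addr0 ?mulf_neq0 //.
move=> [a b] /= /andP[/eqP e ne]; apply/eqP; apply: contraNT ne.
rewrite mulf_eq0 negb_or => /andP[/l1 ha /l2 hb].
have [ea eb] := mo_addE ha hb (esym e).
by apply/eqP; congr pair; apply: val_inj.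
Qed.

Lemma lead1 : lead 1 0%MM.
Proof. by rewrite -mpolyX0; apply: leadX. Qed.

Lemma leadXn p m k : lead p m -> lead (p ^+ k) (m *+ k)%MM.
Proof.
move=> h; elim: k => [|k ih]; first by rewrite expr0 mulm0n; apply: lead1.
by rewrite exprS mulmS; apply: leadM.
Qed.

Lemma lead_prod (I : Type) (r : seq I) (P : pred I) (F : I -> {mpoly K[n]}) f :
  (forall i, P i -> lead (F i) (f i)) ->
  lead (\prod_(i <- r | P i) F i) (\sum_(i <- r | P i) f i)%MM.
Proof.
move=> h; elim: r => [|i r ih]; first by rewrite !big_nil; apply: lead1.
by rewrite !big_cons; case: ifP => // Pi; apply: leadM => //; apply: h.
Qed.

Lemma lead_binomial m1 m2 : m1 != m2 -> lead ('X_[m1] - 'X_[m2]) (mo_max m1 m2).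
Proof.
move=> ne; split=> [|m'].
  rewrite mcoeffB !mcoeffX /mo_max; case: (le m1 m2); rewrite eqxx.
    by rewrite (negbTE ne) sub0r oppr_eq0 oner_neq0.
  by rewrite (eq_sym m2) (negbTE ne) subr0 oner_neq0.
rewrite mcoeffB !mcoeffX; case: (m1 =P m') => [<-|_]; first by rewrite mo_max_l.
by case: (m2 =P m') => [<-|_]; rewrite ?subrr ?eqxx // mo_max_r.
Qed.

(** Pairwise distinct leading monomials cannot cancel, so the largest one with nonzero coefficient
    survives. *)
Lemma lead_lin_comb (I : finType) (e : I -> {mpoly K[n]}) (f : I -> 'X_{1..n})
    (c : I -> K) :
  injective f -> (forall i, lead (e i) (f i)) -> (exists i, c i != 0) ->
  exists i, lead (\sum_i c i *: e i) (f i) /\ forall j, c j != 0 -> le (f j) (f i).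
Proof.
move=> f_inj he [i0 ci0].
(* Reversing the order makes [extremumP] return a maximum. *)
have ge_trans : transitive (fun a b => le b a) by move=> a b d h1 h2; apply: le_trans h2 h1.
have ge_total : total (fun a b => le b a) by move=> a b; apply: le_total.
have [i ci imax] := @extremumP _ _ _ i0 (fun i => c i != 0) f mo_refl ge_trans ge_total ci0.
exists i; split=> //; split=> [|m'].
  rewrite raddf_sum (bigD1 i) //= mcoeffZ big1 ?addr0 ?mulf_neq0 ?(he i).1 //.
  move=> j ji; apply/eqP; rewrite mcoeffZ mulf_eq0; apply: contraNT ji.
  rewrite negb_or => /andP[cj /(he j).2 lij]; apply/eqP/f_inj/le_anti.
  by rewrite lij imax.
rewrite raddf_sum => nz.
have [j] : exists j, (c j *: e j)@_m' != 0.
  apply/existsP; apply: contraNT nz; rewrite negb_exists => /forallP h.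
  by rewrite big1 // => j _; apply/eqP/negPn/h.
rewrite mcoeffZ mulf_eq0 negb_or => /andP[cj /(he j).2 h].
exact: le_trans h (imax _ cj).
Qed.

(* A counting argument replaces straightening: the Q a with mdeg a < d are
   linearly independent and as many as the monomials of degree < d. *)
Lemma lead_comp_mpoly (N : nat) (Q : 'X_{1..N} -> {mpoly K[N]})
    (y : N.-tuple {mpoly K[n]}) (f : 'X_{1..N} -> 'X_{1..n}) (P : {mpoly K[N]}) :
  (forall a, (msize (Q a) <= (mdeg a).+1)%N) ->
  injective f -> (forall a, lead (Q a \mPo y) (f a)) ->
  P \mPo y != 0 -> exists a, lead (P \mPo y) (f a).
Proof.
move=> sQ f_inj leadQ nzP; pose d := msize P; pose T := 'X_{1..N < d}.
pose val_T (i : 'I_#|{: T}|) : 'X_{1..N} := enum_val i.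
have val_T_inj : injective (f \o val_T).
  by move=> i j /f_inj e; apply: enum_val_inj; apply: val_inj.
have msizeQ i : (msize (Q (val_T i)) <= d)%N.
  by apply: leq_trans (sQ _) _; rewrite /val_T; case: (enum_val i).
have coefT (p : {mpoly K[N]}) : (msize p <= d)%N -> (forall j, p@_(val_T j) = 0) -> p = 0.
  move=> sp h; apply/mpolyP=> m; rewrite mcoeff0.
  have [lt|le_m] := ltnP (mdeg m) d; last first.
    by apply: memN_msupp_eq0; apply: msize_mdeg_ge; apply: leq_trans sp le_m.
  by have := h (enum_rank (BMultinom lt)); rewrite /val_T enum_rankK.
have msize_comb (c : 'I_#|{: T}| -> K) :
    (msize (\sum_i c i *: Q (val_T i)) <= d)%N.
  apply: leq_trans (mmeasure_sum _ _ _ _) _; apply/bigmax_leqP_seq => i _ _.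
  exact: leq_trans (msizeZ_le _ _) (msizeQ i).
(* The square matrix of the [Q a] in the basis of monomials of degree below [d]. *)
pose M := \matrix_(i, j) (Q (val_T i))@_(val_T j).
have mulM (r : 'rV[K]_#|{: T}|) j :
    (r *m M) 0 j = (\sum_i r 0 i *: Q (val_T i))@_(val_T j).
  by rewrite mxE raddf_sum; apply: eq_bigr => i _ /=; rewrite mxE mcoeffZ.
have comp_comb (r : 'rV[K]_#|{: T}|) :
    (\sum_i r 0 i *: Q (val_T i)) \mPo y = \sum_i r 0 i *: (Q (val_T i) \mPo y).
  by rewrite raddf_sum; apply: eq_bigr => i _ /=; rewrite comp_mpolyZ.
(* A nonzero row in the kernel would give a vanishing combination of the [Q a], yet after
   substitution it has a leading monomial. *)
have M_unit : M \in unitmx.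
  rewrite -row_free_unit -kermx_eq0; apply/rowV0P => r /sub_kermxP rM0.
  have comb0 : \sum_i r 0 i *: Q (val_T i) = 0.
    by apply: coefT => // j; rewrite -mulM rM0 mxE.
  apply/rowP => i; rewrite mxE; apply/eqP/negPn/negP => ri.
  have [|k [/lead_neq0 + _]] := lead_lin_comb (c := r 0) val_T_inj (fun i => leadQ (val_T i)).
    by exists i.
  by rewrite -comp_comb comb0 comp_mpoly0 eqxx.
(* The coordinates of [P] in the basis formed by the [Q a]. *)
pose r := (\row_j P@_(val_T j)) *m invmx M.
have defP : P = \sum_i r 0 i *: Q (val_T i).
  apply/eqP; rewrite -subr_eq0; apply/eqP/coefT => [|j].
    by apply: leq_trans (mmeasureD_le _ _ _) _; rewrite mmeasureN geq_max leqnn msize_comb.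
  by rewrite mcoeffB -mulM mulmxKV // mxE subrr.
have [|k [lk _]] := lead_lin_comb (c := r 0) val_T_inj (fun i => leadQ (val_T i)).
  apply/existsP; apply: contraNT nzP; rewrite negb_exists => /forallP r0.
  rewrite defP big1 ?comp_mpoly0 // => i _.
  by have := r0 i; rewrite negbK => /eqP ->; rewrite scale0r.
by exists (val_T k); rewrite defP comp_comb.
Qed.

End LeadingMonomial.

(** * Cyclic cofactors of 3 x 3 matrices *)

Definition o0 : 'I_3 := Ordinal (isT : 0 < 3)%N.
Definition o1 : 'I_3 := Ordinal (isT : 1 < 3)%N.
Definition o2 : 'I_3 := Ordinal (isT : 2 < 3)%N.

Lemma ord3_ind (P : 'I_3 -> Prop) : P o0 -> P o1 -> P o2 -> forall i, P i.
Proof.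
move=> P0 P1 P2 [[|[|[|//]]] lt_i]; [move: P0|move: P1|move: P2];
  by congr P; apply: val_inj.
Qed.

Lemma big_ord3 (T : Type) (idx : T) (op : Monoid.law idx) (F : 'I_3 -> T) :
  \big[op/idx]_i F i = op (op (F o0) (F o1)) (F o2).
Proof.
rewrite !big_ord_recl big_ord0 Monoid.mulm1 Monoid.mulmA.
by congr (op (op (F _) (F _)) (F _)); apply: val_inj.
Qed.

Definition nx (i : 'I_3) : 'I_3 :=
  match val i with 0 => o1 | 1 => o2 | _ => o0 end.

Lemma nx3 i : nx (nx (nx i)) = i.
Proof. by elim/ord3_ind: i. Qed.

Lemma nx_neq k i : k != i -> k = nx i \/ k = nx (nx i).
Proof. by elim/ord3_ind: k; elim/ord3_ind: i => //= _; [right|left|left|right|right|left]. Qed.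

(* Indexing rows and columns cyclically absorbs the cofactor signs. *)
Definition cofm (R : comNzRingType) (X : 'M[R]_3) : 'M[R]_3 :=
  \matrix_(k, l) (X (nx k) (nx l) * X (nx (nx k)) (nx (nx l))
                  - X (nx k) (nx (nx l)) * X (nx (nx k)) (nx l)).

Lemma det_mx3 (R : comNzRingType) (X : 'M[R]_3) :
  \det X = X o0 o0 * cofm X o0 o0 + X o0 o1 * cofm X o0 o1 + X o0 o2 * cofm X o0 o2.
Proof.
(* Entries indexed by naturals let [ring] identify equal indices that carry different bound
   proofs. *)
have [g XE] : exists g : nat -> nat -> R, forall i j, X i j = g i j.
  by exists (fun i j => X (inord i) (inord j)) => i j; rewrite !inord_val.
rewrite (expand_det_row _ o0) big_ord3 /cofactor.
rewrite !(expand_det_row _ ord0) !big_ord_recl !big_ord0 /cofactor !det_mx11 !mxE.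
rewrite !XE /=; ring.
Qed.

(** The double adjugate identity; its diagonal entries are the relations
    [Y_jj Y_kk - Y_jk Y_kj = X_ii det X] behind the trades. *)
Lemma cofm_cofm (R : comNzRingType) (X : 'M[R]_3) i j :
  cofm (cofm X) i j = X i j * \det X.
Proof.
have [g XE] : exists g : nat -> nat -> R, forall i j, X i j = g i j.
  by exists (fun i j => X (inord i) (inord j)) => a b; rewrite !inord_val.
by rewrite det_mx3; elim/ord3_ind: i; elim/ord3_ind: j; rewrite !mxE !XE /=; ring.
Qed.

(** * Trading products of cofactors *)

(** The index other than [k] and [l]; the value at [k = l] is arbitrary, all uses being guarded by
    [k != l]. *)
Definition third (k l : 'I_3) : 'I_3 := if l == nx k then nx l else nx k.

(* [nl i] says that Y_jk Y_kj, j = i + 1, k = i + 2, is to be replaced by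
   X_ii det X; [swaps nl a i] is the number of such replacements and
   [straight nl a] the exponent of the cofactors that are left. *)
Definition straight (nl : pred 'I_3) (a : 'I_3 -> 'I_3 -> nat) k l :=
  if (k != l) && nl (third k l) then (a k l - a l k)%N else a k l.

Definition swaps (nl : pred 'I_3) (a : 'I_3 -> 'I_3 -> nat) i :=
  if nl i then minn (a (nx i) (nx (nx i))) (a (nx (nx i)) (nx i)) else 0%N.

(** Truncated difference plus minimum restores the exponent, so [a] can be recovered from the trades
    and the remainder. *)
Lemma straight_swaps (nl : pred _) a k l :
  a k l = (straight nl a k l + (if k != l then swaps nl a (third k l) else 0))%N.
Proof.
rewrite /straight /swaps; elim/ord3_ind: k; elim/ord3_ind: l => /=;
  rewrite ?addn0 //; case: ifP; rewrite ?addn0 //= /nx /=; lia.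
Qed.

Lemma straight_excl (nl : pred _) a k l : k != l -> nl (third k l) ->
  (straight nl a k l == 0)%N || (straight nl a l k == 0)%N.
Proof.
rewrite /straight; elim/ord3_ind: k; elim/ord3_ind: l => //= _;
  rewrite /third /nx /= => ->; lia.
Qed.

(** A trade consumes two cofactors and yields a quadratic in the cofactors, whence the weight 2.
    This supplies the degree bound of [lead_comp_mpoly]. *)
Lemma straight_degree (nl : pred _) a :
  (\sum_k \sum_l straight nl a k l + \sum_i 2 * swaps nl a i
     = \sum_k \sum_l a k l)%N.
Proof.
rewrite /straight /swaps !big_ord3 /third /nx /=.
by case: (nl o0); case: (nl o1); case: (nl o2); rewrite /=; lia.
Qed.

(* [g k l] says that the antidiagonal product leads in the cofactor Y_kl, and
   [w k l i j] is then the exponent of X_ij in the leading monomial of Y_kl. *)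
Lemma lead_exponents_inj (g : 'I_3 -> 'I_3 -> bool) (a b : 'I_3 -> 'I_3 -> nat) :
  (forall k, g k k) ->
  (forall k, ~~ (g k (nx k) && g k (nx (nx k)))) ->
  (forall k, ~~ (g (nx k) k && g (nx (nx k)) k)) ->
  (forall k l, k != l -> ~~ g k l -> ~~ g l k -> (a k l == 0) || (a l k == 0)) ->
  (forall k l, k != l -> ~~ g k l -> ~~ g l k -> (b k l == 0) || (b l k == 0)) ->
  let w k l i j := if g k l
    then ((nx k == i) && (nx (nx l) == j) + ((nx (nx k) == i) && (nx l == j)))%N
    else ((nx k == i) && (nx l == j) + ((nx (nx k) == i) && (nx (nx l) == j)))%N in
  (forall i j, \sum_k \sum_l w k l i j * a k l = \sum_k \sum_l w k l i j * b k l)%N ->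
  forall k l, a k l = b k l.
Proof.
move=> gd gr gc ha hb w e.
suff h : [/\ a o0 o0 = b o0 o0, a o0 o1 = b o0 o1 & a o0 o2 = b o0 o2] /\
         [/\ a o1 o0 = b o1 o0, a o1 o1 = b o1 o1 & a o1 o2 = b o1 o2] /\
         [/\ a o2 o0 = b o2 o0, a o2 o1 = b o2 o1 & a o2 o2 = b o2 o2].
  by case: h => [[? ? ?] [[? ? ?] [? ? ?]]]; elim/ord3_ind; elim/ord3_ind.
move: (ha o0 o1 isT) (ha o1 o2 isT) (ha o0 o2 isT).
move: (hb o0 o1 isT) (hb o1 o2 isT) (hb o0 o2 isT) => {ha hb}.
move: (e o0 o0) (e o0 o1) (e o0 o2) (e o1 o0) (e o1 o1) (e o1 o2) (e o2 o0) (e o2 o1) (e o2 o2).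
rewrite !big_ord3 /w /= {w e} !gd.
move: (gr o0) (gr o1) (gr o2) (gc o0) (gc o1) (gc o2) => /=.
(* For each pattern of leading terms allowed by [gr] and [gc], the nine equations and the exclusions
   form a linear problem over the naturals. *)
case: (g o0 o1); case: (g o0 o2) => //= _; case: (g o1 o0); case: (g o1 o2) => //= _;
  case: (g o2 o0); case: (g o2 o1) => //= _ _ _ _ *;
  (do !split); lia.
Qed.

(** * Degree bounds and closure properties of generated subalgebras *)

Lemma degM_le (K : fieldType) (n : nat) (p q : {mpoly K[n]}) d e :
  (msize p <= d.+1)%N -> (msize q <= e.+1)%N ->
  (msize (p * q) <= (d + e).+1)%N.
Proof.
move=> hp hq; have [->|p0] := eqVneq p 0; first by rewrite mul0r mmeasure0.
have [->|q0] := eqVneq q 0; first by rewrite mulr0 mmeasure0.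
by rewrite msizeM //; move: (msize p) (msize q) hp hq => *; lia.
Qed.

Lemma degXn_le (K : fieldType) (n : nat) (p : {mpoly K[n]}) d k :
  (msize p <= d.+1)%N -> (msize (p ^+ k) <= (d * k).+1)%N.
Proof.
move=> hp; elim: k => [|k ih]; first by rewrite expr0 msize1.
by rewrite exprS mulnS; apply: degM_le.
Qed.

Lemma deg_prod_le (K : fieldType) (n : nat) (I : finType)
    (F : I -> {mpoly K[n]}) f :
  (forall i, msize (F i) <= (f i).+1)%N ->
  (msize (\prod_i F i) <= (\sum_i f i).+1)%N.
Proof.
move=> h; elim: (index_enum I) => [|i r ih]; first by rewrite !big_nil msize1.
by rewrite !big_cons; apply: degM_le.
Qed.

Lemma alg_gen_sub (K : fieldType) (n : nat) (S T : {mpoly K[n]} -> Prop) p :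
  (forall q, S q -> alg_gen T q) -> alg_gen S p -> alg_gen T p.
Proof.
by move=> ST; elim=> {p} [p /ST||p q _ hp _ hq|p q _ hp _ hq|c p _ hp] //;
  [apply: alg_gen_one|apply: alg_gen_add|apply: alg_gen_mul|apply: alg_gen_scale].
Qed.

Lemma alg_gen_opp (K : fieldType) (n : nat) (S : {mpoly K[n]} -> Prop) p :
  alg_gen S p -> alg_gen S (- p).
Proof. by move=> h; rewrite -scaleN1r; apply: alg_gen_scale. Qed.

Lemma alg_gen_exp (K : fieldType) (n : nat) (S : {mpoly K[n]} -> Prop) p k :
  alg_gen S p -> alg_gen S (p ^+ k).
Proof.
move=> h; elim: k => [|k ih]; first by rewrite expr0; apply: alg_gen_one.
by rewrite exprS; apply: alg_gen_mul.
Qed.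

Lemma alg_gen_prod (K : fieldType) (n : nat) (S : {mpoly K[n]} -> Prop)
    (I : finType) (F : I -> {mpoly K[n]}) :
  (forall i, alg_gen S (F i)) -> alg_gen S (\prod_i F i).
Proof.
move=> h; elim: (index_enum I) => [|i r ih].
  by rewrite big_nil; apply: alg_gen_one.
by rewrite big_cons; apply: alg_gen_mul.
Qed.

(** * Initial monomials for a matrix of distinct variables *)

Section DistinctVariables.

Variables (K : fieldType) (n : nat) (le : rel 'X_{1..n}).
Hypothesis leP : monomial_order le.
Variable v : 'I_3 -> 'I_3 -> 'I_n.
Hypothesis v_inj : forall i j i' j', v i j = v i' j' -> i = i' /\ j = j'.

Local Notation u i j := (U_(v i j)%MM).
Local Notation X := (\matrix_(i, j) 'X_(v i j) : 'M[{mpoly K[n]}]_3).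

Let uE i j i' j' : (u i j) (v i' j') = ((i == i') && (j == j')) :> nat.
Proof.
rewrite mnm1E; congr nat_of_bool; apply/eqP/andP => [/v_inj[-> ->]|[/eqP-> /eqP->] //].
by rewrite !eqxx.
Qed.

Let dg k l := (u (nx k) (nx l) + u (nx (nx k)) (nx (nx l)))%MM.
Let ad k l := (u (nx k) (nx (nx l)) + u (nx (nx k)) (nx l))%MM.
Let g k l := le (dg k l) (ad k l).
Let cm k l := mo_max le (dg k l) (ad k l).

Let dg_neq_ad k l : dg k l != ad k l.
Proof.
apply/eqP=> /(congr1 (fun m : 'X_{1..n} => m (v (nx k) (nx l)))).
rewrite !mnmDE !uE; elim/ord3_ind: k; elim/ord3_ind: l => /=; lia.
Qed.

Lemma lead_cofm k l : lead le (cofm X k l) (cm k l).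
Proof.
by rewrite !mxE -!mpolyXD; apply: (lead_binomial leP K (dg_neq_ad k l)).
Qed.

(** * Consequences of a smallest diagonal product *)

Hypothesis diag_min : forall s : {perm 'I_3},
  le (\sum_i u i i)%MM (\sum_i u i (s i))%MM.

(** Compare the identity with the transposition of the other two indices and cancel [X_kk]. *)
Let g_diag k : g k k.
Proof.
have sumD (f : 'I_3 -> 'X_{1..n}) :
    (\sum_i f i = f (nx k) + f (nx (nx k)) + f k)%MM.
  by apply/mnmP=> i; rewrite big_ord3 !mnmDE; elim/ord3_ind: k; rewrite /nx /=; lia.
have := diag_min (tperm (nx k) (nx (nx k))); rewrite !sumD tpermL tpermR.
by rewrite tpermD; [move/(mo_addIr leP)| |]; elim/ord3_ind: k {sumD}.
Qed.

Let sum3_contra m1 m2 m3 p1 p2 p3 : le m1 p1 -> le m2 p2 -> le m3 p3 ->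
  m1 != p1 -> (m1 + m2 + m3 <> p1 + p2 + p3)%MM.
Proof.
move=> h1 h2 h3 /eqP ne /(mo_addE leP (mo_addD leP h1 h2) h3)[].
by move=> /(mo_addE leP h1 h2)[].
Qed.

(** Over the three cofactors of a row, the diagonal and the antidiagonal terms have the same
    product, namely all variables of the two other rows. Hence the antidiagonal cannot lead in all
    three. *)
Let g_row k : ~~ (g k (nx k) && g k (nx (nx k))).
Proof.
apply/andP=> -[h1 h2]; apply: (sum3_contra (g_diag k) h1 h2 (dg_neq_ad k k)).
by apply/mnmP=> i; rewrite /dg /ad !mnmDE !nx3; lia.
Qed.

Let g_col k : ~~ (g (nx k) k && g (nx (nx k)) k).
Proof.
apply/andP=> -[h1 h2]; apply: (sum3_contra (g_diag k) h1 h2 (dg_neq_ad k k)).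
by apply/mnmP=> i; rewrite /dg /ad !mnmDE !nx3; lia.
Qed.

(* These two cofactors are the only ones in whose leading term X_ii can occur:
   by [g_diag] it does not occur in those of Y_jj and Y_kk. *)
Definition nonlead i := ~~ g (nx i) (nx (nx i)) && ~~ g (nx (nx i)) (nx i).

(** Both sides are the two terms of one 2-minor through [X_ii]: a principal one, settled by
    [g_diag], if [k = j], and otherwise one of the two in [nonlead]. *)
Lemma nonlead_lt i k j : nonlead i -> k != i -> j != i ->
  le (u i i + u k j)%MM (u i j + u k i)%MM.
Proof.
have ngE a b : ~~ g a b -> le (ad a b) (dg a b).
  by move=> h; have := mo_total leP (ad a b) (dg a b); rewrite -/(g a b) (negbTE h) orbF.
move=> /andP[/ngE h1 /ngE h2] /nx_neq[] -> /nx_neq[] ->.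
- by have := g_diag (nx (nx i)); rewrite /g /dg /ad !nx3.
- by move: h2; rewrite /dg /ad !nx3.
- by move: h1; rewrite /dg /ad !nx3 addmC [X in le _ X]addmC.
- by have := g_diag (nx i); rewrite /g /dg /ad !nx3 addmC [X in le _ X]addmC.
Qed.

Let dmon (s : {perm 'I_3}) := (\sum_i u i (s i))%MM.

Let dmonE s i j : dmon s (v i j) = (s i == j).
Proof.
rewrite /dmon mnm_sumE (bigD1 i) //= uE eqxx /= big1 ?addn0 // => k /negbTE.
by rewrite uE => ->.
Qed.

Let dmon_inj : injective dmon.
Proof.
move=> s t e; apply/permP=> i; apply/eqP; rewrite eq_sym.
have := congr1 (fun m : 'X_{1..n} => m (v i (s i))) e.
by rewrite !dmonE eqxx; case: eqP.
Qed.

Lemma lead_det : exists2 d, lead le (\det X) d &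
  forall i, nonlead i -> d (v i i) = 0%N.
Proof.
have nz (s : {perm 'I_3}) : (-1) ^+ s != 0 :> K by rewrite signr_eq0.
have detE : \det X = \sum_(s : {perm 'I_3}) (-1) ^+ s *: 'X_[dmon s].
  apply: eq_bigr => s _; rewrite -mul_mpolyC /dmon.
  rewrite (big_morph _ (@mpolyXD n K) (@mpolyX0 n K)).
  rewrite rmorphXn rmorphN rmorph1; congr (_ * _).
  by apply: eq_bigr => i _; rewrite mxE.
have [|s [ls smax]] := lead_lin_comb leP (c := fun s : {perm 'I_3} => (-1) ^+ s : K)
  dmon_inj (fun s => leadX leP K (dmon s)).
  by exists 1%g.
exists (dmon s) => [|i nli]; first by rewrite detE.
rewrite dmonE; apply/eqP; rewrite eqb0; apply/eqP => si.
have ne : nx i != i by elim/ord3_ind: i {nli si}.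
(* If the leading [s] fixed [i], exchanging the images of [i] and [nx i] would not decrease the
   monomial, by [nonlead_lt]. Maximality then forces [s = t], which is absurd. *)
pose t := (tperm i (nx i) * s)%g.
have ti : t i = s (nx i) by rewrite permM tpermL.
have tn : t (nx i) = i by rewrite permM tpermR.
have lt : le (dmon s) (dmon t).
  rewrite /dmon (bigD1 i) // (bigD1 (nx i)) //= [X in le _ X](bigD1 i) //=.
  rewrite [X in le _ (_ + X)%MM](bigD1 (nx i)) //= !addmA.
  rewrite (eq_bigr (fun j => u j (t j))) => [|j /andP[ji jn]].
    apply: (mo_add leP); rewrite ti tn si; apply: nonlead_lt => //.
    by rewrite -{2}si (inj_eq perm_inj).
  by rewrite permM tpermD // eq_sym.
have e : s = t by apply/dmon_inj/(mo_anti leP); rewrite lt smax.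
by move: ti; rewrite -e si => /esym/eqP; rewrite -{2}si (inj_eq perm_inj) (negbTE ne).
Qed.

(** The leading monomial of the traded product attached to [a], with [d] standing for that of
    [det X]. *)
Definition sagbi_mon (d : 'X_{1..n}) (a : 'I_3 -> 'I_3 -> nat) : 'X_{1..n} :=
  (\sum_k \sum_l cm k l *+ straight nonlead a k l
     + \sum_i (u i i + d) *+ swaps nonlead a i)%MM.

Let cmE k l i j : cm k l (v i j) = if g k l
    then ((nx k == i) && (nx (nx l) == j) + ((nx (nx k) == i) && (nx l == j)))%N
    else ((nx k == i) && (nx l == j) + ((nx (nx k) == i) && (nx (nx l) == j)))%N.
Proof.
by rewrite /cm /mo_max -/(g k l); case: ifP => _; rewrite mnmDE !uE.
Qed.

Let cm_nonlead k l i : nonlead i -> cm k l (v i i) = 0%N.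
Proof.
move=> /andP[/negbTE h1 /negbTE h2]; move: (g_diag (nx i)) (g_diag (nx (nx i))).
move: h1 h2; rewrite cmE.
by elim/ord3_ind: i => /=; elim/ord3_ind: k; elim/ord3_ind: l => //= h1 h2 h3 h4;
  rewrite /= ?(h1, h2, h3, h4) //; case: ifP.
Qed.

Lemma sagbi_mon_inj (d : 'X_{1..n}) (a b : 'I_3 -> 'I_3 -> nat) :
  (forall i, nonlead i -> d (v i i) = 0%N) ->
  sagbi_mon d a = sagbi_mon d b -> forall k l, a k l = b k l.
Proof.
move=> d0 e.
(* For nonleading [i], neither the cofactors nor [det X] contribute [X_ii] to the leading monomial;
   only the factors [X_ii det X] do. *)
have swaps_exponent (c : 'I_3 -> 'I_3 -> nat) i :
    nonlead i -> sagbi_mon d c (v i i) = swaps nonlead c i.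
  move=> nli; rewrite mnmDE !mnm_sumE big1 => [|k _]; last first.
    by rewrite mnm_sumE big1 // => l _; rewrite mulmnE cm_nonlead.
  rewrite add0n (bigD1 i) //= mulmnE mnmDE uE eqxx d0 // mul1n big1 ?addn0 //.
  by move=> j ji; rewrite mulmnE mnmDE uE d0 // (negbTE ji).
have eswaps i : swaps nonlead a i = swaps nonlead b i.
  have [nli|/negbTE nli] := boolP (nonlead i); last by rewrite /swaps nli.
  by rewrite -!swaps_exponent // e.
have {e} e : (\sum_k \sum_l cm k l *+ straight nonlead a k l)%MM
           = (\sum_k \sum_l cm k l *+ straight nonlead b k l)%MM.
  apply: (@addIm _ (\sum_i (u i i + d) *+ swaps nonlead a i)%MM).
  by rewrite [LHS]e /sagbi_mon; congr (_ + _)%MM; apply: eq_bigr => i _; rewrite eswaps.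
suff estr k l : straight nonlead a k l = straight nonlead b k l.
  by move=> k l; rewrite (straight_swaps nonlead a) (straight_swaps nonlead b) estr eswaps.
(* If the diagonal term leads in both [Y_kl] and [Y_lk], the third index is nonleading, so trading
   has already emptied one of the two exponents. *)
have nlE k' l' : k' != l' -> ~~ g k' l' -> ~~ g l' k' -> nonlead (third k' l').
  rewrite /nonlead; elim/ord3_ind: k'; elim/ord3_ind: l' => //= _ h1 h2;
  by rewrite /third /= /nx /= ?h1 ?h2.
apply: (@lead_exponents_inj g) => //= [k' l' kl h1 h2|k' l' kl h1 h2|i j].
- by apply: straight_excl => //; apply: nlE.
- by apply: straight_excl => //; apply: nlE.
have := congr1 (fun m : 'X_{1..n} => m (v i j)) e; rewrite !mnm_sumE.
have sumE (c : 'I_3 -> 'I_3 -> nat) :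
    (\sum_k (\sum_l cm k l *+ c k l)%MM (v i j)
      = \sum_k \sum_l cm k l (v i j) * c k l)%N.
  by apply: eq_bigr => k' _; rewrite mnm_sumE; apply: eq_bigr => l' _; rewrite mulmnE.
rewrite !sumE; under eq_bigr => k' _ do under eq_bigr => l' _ do rewrite cmE.
by under [RHS]eq_bigr => k' _ do under eq_bigr => l' _ do rewrite cmE.
Qed.

Let cof_tuple : (3 * 3).-tuple {mpoly K[n]} := [tuple mxvec (cofm X) 0 i | i < 3 * 3].

Let comp_gen k l : gen_mx K 3 3 k l \mPo cof_tuple = cofm X k l.
Proof. by rewrite [gen_mx _ _ _ k l]mxE comp_mpolyXU -tnth_nth tnth_mktuple mxvecE. Qed.

(** The traded product before substitution: the variables stand for the cofactors, and a 2-minor in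
    them becomes [X_ii det X] by [cofm_cofm]. *)
Definition straight_poly (a : 'X_{1..3 * 3}) : {mpoly K[3 * 3]} :=
  let a' k l := a (mxvec_index k l) in
  (\prod_k \prod_l gen_mx K 3 3 k l ^+ straight nonlead a' k l)
  * \prod_i cofm (gen_mx K 3 3) i i ^+ swaps nonlead a' i.

Let straight_poly_size a : (msize (straight_poly a) <= (mdeg a).+1)%N.
Proof.
have -> : mdeg a = (\sum_k \sum_l a (mxvec_index k l))%N.
  rewrite mdegE pair_big (reindex (uncurry (@mxvec_index 3 3))); last exact: curry_mxvec_bij.
  by apply: eq_big => -[k l].
rewrite -(straight_degree nonlead); apply: degM_le.
  apply: deg_prod_le => k; apply: deg_prod_le => l.
  by rewrite -[X in (_ <= X.+1)%N]mul1n; apply: degXn_le; rewrite mxE msizeX mdeg1.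
apply: deg_prod_le => i; apply: degXn_le.
rewrite !mxE -!mpolyXD; apply: leq_trans (mmeasureD_le _ _ _) _.
by rewrite mmeasureN !msizeX !mdegD !mdeg1.
Qed.

Lemma lead_cof_alg d P :
  lead le (\det X) d -> (forall i, nonlead i -> d (v i i) = 0%N) ->
  P \mPo cof_tuple != 0 -> exists a, lead le (P \mPo cof_tuple) (sagbi_mon d a).
Proof.
move=> ld d0 nz.
have [||a la] := @lead_comp_mpoly _ _ leP K _ straight_poly cof_tuple
  (fun a => sagbi_mon d (fun k l => a (mxvec_index k l))) P straight_poly_size _ _ nz.
- move=> a b /(sagbi_mon_inj d0) h; apply/mnmP => i.
  by case/mxvec_indexP: i => k l; apply: h.
- move=> a; rewrite /straight_poly rmorphM !rmorph_prod; apply: leadM => //.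
    apply: lead_prod => // k _; rewrite rmorph_prod; apply: lead_prod => // l _.
    by rewrite rmorphXn; apply: leadXn => //=; rewrite comp_gen; apply: lead_cofm.
  apply: lead_prod => // i _; rewrite rmorphXn; apply: leadXn => //=.
  have -> : cofm (gen_mx K 3 3) i i \mPo cof_tuple = cofm (cofm X) i i.
    rewrite ![cofm _ i i]mxE comp_mpolyB !rmorphM /=.
    by rewrite !comp_gen.
  by rewrite cofm_cofm mxE; apply: leadM => //; apply: leadX.
by exists (fun k l => a (mxvec_index k l)).
Qed.

Lemma sagbi_mon_gen (S : {mpoly K[n]} -> Prop) d a :
  (forall k l m, lead le (cofm X k l) m -> S 'X_[m]) ->
  (forall i, nonlead i -> S 'X_[(u i i + d)%MM]) ->
  alg_gen S 'X_[sagbi_mon d a].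
Proof.
move=> Scof Sdet; rewrite /sagbi_mon mpolyXD; apply: alg_gen_mul.
  rewrite (big_morph _ (@mpolyXD n K) (@mpolyX0 n K)); apply: alg_gen_prod => k.
  rewrite (big_morph _ (@mpolyXD n K) (@mpolyX0 n K)); apply: alg_gen_prod => l.
  by rewrite -mpolyXn; apply/alg_gen_exp/alg_gen_in/Scof/lead_cofm.
rewrite (big_morph _ (@mpolyXD n K) (@mpolyX0 n K)); apply: alg_gen_prod => i.
rewrite -mpolyXn /swaps; case: ifP => [nli|_]; last by rewrite expr0; apply: alg_gen_one.
exact/alg_gen_exp/alg_gen_in/Sdet.
Qed.

End DistinctVariables.

(** * Sagbi bases of the algebra of 2-minors *)

(** Leading monomials multiply, so their span is already a subalgebra; this gives one inclusion, and
    the hypothesis on single elements gives the other. *)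
Lemma sagbi_basis_of_gen (K : fieldType) (n : nat) (le : rel 'X_{1..n})
    (G F : {mpoly K[n]} -> Prop) :
  monomial_order le -> (forall f, F f -> alg_gen G f) ->
  (forall f, alg_gen G f -> f != 0 -> alg_gen (in_mons le F) 'X_[in_mon le f]) ->
  sagbi_basis le (alg_gen G) F.
Proof.
move=> leP FA h; split=> // p; split; last first.
  elim=> {p} [_ [f [Af f0 ->]]||p q _ hp _ hq|c p _ hp]; first exact: h.
  - by rewrite -(scale0r 1); apply/alg_gen_scale/alg_gen_one.
  - exact: alg_gen_add.
  - exact: alg_gen_scale.
have spanM q r : Defs.in_alg le (alg_gen G) q -> Defs.in_alg le (alg_gen G) r ->
    Defs.in_alg le (alg_gen G) (q * r).
  move=> hq hr; elim: hq => {q} [_ [f [Af f0 ->]]||p1 p2 _ ih1 _ ih2|c p1 _ ih1].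
  - elim: hr => {r} [_ [f' [Af' f'0 ->]]||p1 p2 _ ih1 _ ih2|c p1 _ ih1].
    + apply: lin_span_in; exists (f * f'); split; rewrite ?mulf_neq0 //.
        exact: alg_gen_mul.
      rewrite -mpolyXD; congr 'X_[_]; apply/esym/(in_monE leP).
      by apply: leadM => //; apply: lead_in_mon.
    + by rewrite mulr0; apply: lin_span_zero.
    + by rewrite mulrDr; apply: lin_span_add.
    + by rewrite -scalerAr; apply: lin_span_scale.
  - by rewrite mul0r; apply: lin_span_zero.
  - by rewrite mulrDl; apply: lin_span_add.
  - by rewrite -scalerAl; apply: lin_span_scale.
elim=> {p} [_ [f [Ff f0 ->]]||p q _ hp _ hq|p q _ hp _ hq|c p _ hp].
- by apply: lin_span_in; exists f; split=> //; apply: FA.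
- apply: lin_span_in; exists 1; split; rewrite ?oner_neq0 //; first exact: alg_gen_one.
  by rewrite (in_monE leP (lead1 leP K)) mpolyX0.
- exact: lin_span_add.
- exact: spanM.
- exact: lin_span_scale.
Qed.

(** Serves to pass from at most three adjoined elements to all nine. *)
Lemma sagbi_basis_mono (K : fieldType) (n : nat) (le : rel 'X_{1..n})
    (G F F' : {mpoly K[n]} -> Prop) :
  monomial_order le -> (forall f, F f -> F' f) -> (forall f, F' f -> alg_gen G f) ->
  sagbi_basis le (alg_gen G) F -> sagbi_basis le (alg_gen G) F'.
Proof.
move=> leP FF' F'A [_ FG]; apply: sagbi_basis_of_gen => // f Af f0.
have /FG : Defs.in_alg le (alg_gen G) 'X_[in_mon le f] by apply: lin_span_in; exists f.
apply: alg_gen_sub => _ [f' [Ff' f'0 ->]]; apply: alg_gen_in.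
by exists f'; split=> //; apply: FF'.
Qed.

Lemma det_mx2 (R : comNzRingType) (M : 'M[R]_2) :
  \det M = M 0 0 * M 1 1 - M 0 1 * M 1 0.
Proof.
have [g ME] : exists g : nat -> nat -> R, forall i j, M i j = g i j.
  by exists (fun i j => M (inord i) (inord j)) => i j; rewrite !inord_val.
rewrite (expand_det_row _ ord0) !big_ord_recl big_ord0 /cofactor !det_mx11 !mxE.
by rewrite !ME /=; ring.
Qed.

(** * The 2-minors as signed cofactors of a column-permuted matrix *)

Section TwoMinors.

Variable K : fieldType.

Local Notation X := (gen_mx K 3 3).
Local Notation A := (minor_alg K 2 3 3).

Let D i i' j j' := X i j * X i' j' - X i j' * X i' j.

Let minorE (f g : 'I_2 -> 'I_3) :
  \det (mxsub f g X) = D (f 0) (f 1) (g 0) (g 1).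
Proof. by rewrite det_mx2 ![mxsub _ _ _ _ _]mxE. Qed.

Let D_minor_lt (i i' j j' : 'I_3) : (i < i')%N -> (j < j')%N -> minors K 2 3 3 (D i i' j j').
Proof.
move=> ii jj; exists (fun a => if a == 0 then i else i'), (fun a => if a == 0 then j else j').
split; last by rewrite minorE.
  by move=> [[|[|//]] ?] [[|[|//]] ?].
by move=> [[|[|//]] ?] [[|[|//]] ?].
Qed.

Let D_minor (i i' j j' : 'I_3) : i != i' -> j != j' ->
  exists2 p, minors K 2 3 3 p & D i i' j j' = p \/ D i i' j j' = - p.
Proof.
have Dl : D i' i j j' = - D i i' j j' by rewrite /D; ring.
have Dr : D i i' j' j = - D i i' j j' by rewrite /D; ring.
have Dlr : D i' i j' j = D i i' j j' by rewrite /D; ring.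
case: (ltngtP i i') => [ii _|ii _|/val_inj -> /eqP //];
  case: (ltngtP j j') => [jj _|jj _|/val_inj -> /eqP //].
- by exists (D i i' j j'); [apply: D_minor_lt|left].
- by exists (D i i' j' j); [apply: D_minor_lt|right; rewrite Dr opprK].
- by exists (D i' i j j'); [apply: D_minor_lt|right; rewrite Dl opprK].
- by exists (D i' i j' j); [apply: D_minor_lt|left].
Qed.

Let cofD (s : {perm 'I_3}) k l : cofm (col_perm s X) k l =
  D (nx k) (nx (nx k)) (s (nx l)) (s (nx (nx l))).
Proof. by rewrite /D !mxE. Qed.

Let nx_neq2 k : nx k != nx (nx k).
Proof. by elim/ord3_ind: k. Qed.

Lemma cofm_minor (s : {perm 'I_3}) k l : exists2 p, minors K 2 3 3 p &
  cofm (col_perm s X) k l = p \/ cofm (col_perm s X) k l = - p.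
Proof. by rewrite cofD; apply: D_minor; rewrite ?(inj_eq perm_inj) nx_neq2. Qed.

Lemma minor_cofm (s : {perm 'I_3}) p : minors K 2 3 3 p -> exists k l,
  p = cofm (col_perm s X) k l \/ p = - cofm (col_perm s X) k l.
Proof.
have pairP i i' : i != i' -> exists k,
    (i = nx k /\ i' = nx (nx k)) \/ (i = nx (nx k) /\ i' = nx k).
  elim/ord3_ind: i; elim/ord3_ind: i' => // _.
  - by exists o2; left.
  - by exists o1; right.
  - by exists o2; right.
  - by exists o0; left.
  - by exists o1; left.
  - by exists o0; right.
case=> f [g [f_lt g_lt ->]]; rewrite minorE.
have /pairP[k hk] : f 0 != f 1 by rewrite -(inj_eq val_inj) ltn_eqF // f_lt.
(* The selected columns are pulled back through [s] before being matched with a cyclic pair. *)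
have /pairP[l hl] : (s^-1)%g (g 0) != (s^-1)%g (g 1).
  by rewrite (inj_eq perm_inj) -(inj_eq val_inj) ltn_eqF // g_lt.
have {hl} hl : (g 0 = s (nx l) /\ g 1 = s (nx (nx l))) \/
               (g 0 = s (nx (nx l)) /\ g 1 = s (nx l)).
  by case: hl => -[<- <-]; rewrite !permKV; [left|right].
exists k, l; rewrite !cofD.
case: hk => -[-> ->]; case: hl => -[-> ->]; [left|right|right|left]; rewrite /D; ring.
Qed.

Lemma cofm_in_alg (s : {perm 'I_3}) k l : A (cofm (col_perm s X) k l).
Proof.
have [p /(@alg_gen_in K) Ap [->|->]] := cofm_minor s k l => //.
exact: alg_gen_opp.
Qed.

Lemma det_col_perm (R : comNzRingType) m (s : {perm 'I_m}) (M : 'M[R]_m) :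
  \det (col_perm s M) = (-1) ^+ s * \det M.
Proof. by rewrite col_permE det_mulmx det_perm odd_permV mulrC. Qed.

(** Exchanging columns [i] and [j] moves [X_ij] to the diagonal, where [cofm_cofm] writes it, times
    the determinant up to sign, as a quadratic in cofactors. *)
Lemma entry_mul_det_in_alg i j : A (X i j * \det X).
Proof.
have e : A (cofm (cofm (col_perm (tperm i j) X)) i i).
  rewrite mxE; apply: alg_gen_add; last apply: alg_gen_opp;
    by apply: alg_gen_mul; apply: cofm_in_alg.
move: e; rewrite cofm_cofm det_col_perm mulrCA mxE tpermL.
case: (odd_perm _); rewrite ?mul1r // mulN1r => /alg_gen_opp.
by rewrite opprK.
Qed.

Lemma minors_adjoin_sub E p : minors_adjoin K E p -> A p.
Proof. by case=> [|[e _ ->]]; [apply: alg_gen_in|apply: entry_mul_det_in_alg]. Qed.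

Lemma minor_alg_comp (s : {perm 'I_3}) p : A p -> exists P : {mpoly K[3 * 3]},
  p = P \mPo [tuple mxvec (cofm (col_perm s X)) 0 i | i < 3 * 3].
Proof.
elim=> {p} [p /(minor_cofm s)[k [l hp]]||_ _ _ [P ->] _ [Q ->]
           |_ _ _ [P ->] _ [Q ->]|c _ _ [P ->]].
- have e : 'X_(mxvec_index k l) \mPo [tuple mxvec (cofm (col_perm s X)) 0 i | i < 3 * 3]
    = cofm (col_perm s X) k l by rewrite comp_mpolyXU -tnth_nth tnth_mktuple mxvecE.
  case: hp => ->; first by exists 'X_(mxvec_index k l).
  by exists (- 'X_(mxvec_index k l)); rewrite comp_mpolyN e.
- by exists 1; rewrite comp_mpoly1.
- by exists (P + Q); rewrite comp_mpolyD.
- by exists (P * Q); rewrite rmorphM.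
- by exists (c *: P); rewrite comp_mpolyZ.
Qed.

Lemma sagbi_two_minors (le : rel 'X_{1..3 * 3}) : monomial_order le ->
  exists2 E : {set 'I_3 * 'I_3}, (#|E| <= 3)%N & sagbi_basis le A (minors_adjoin K E).
Proof.
move=> leP.
pose dm (s : {perm 'I_3}) := (\sum_i U_(@mxvec_index 3 3 i (s i)))%MM.
(* The permutation with the smallest monomial in [det X]; permuting columns by it puts that monomial
   on the diagonal. *)
have [s _ smin] := @extremumP _ _ _ 1%g predT dm
  (mo_refl leP) (mo_trans leP) (mo_total leP) isT.
pose v i j := @mxvec_index 3 3 i (s j).
have v_inj i j i' j' : v i j = v i' j' -> i = i' /\ j = j'.
  by move=> /cast_ord_inj /enum_rank_inj [-> /perm_inj].
have defX : (\matrix_(i, j) 'X_(v i j) : 'M[{mpoly K[3 * 3]}]_3) = col_perm s X.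
  by apply/matrixP => i j; rewrite !mxE.
have diag_min (t : {perm 'I_3}) : le (\sum_i U_(v i i))%MM (\sum_i U_(v i (t i)))%MM.
  have := smin (t * s)%g isT; rewrite /dm.
  by under [X in le _ X]eq_bigr => i _ do rewrite permM.
have [d ld d0] := lead_det K leP v_inj diag_min.
(* One position per nonleading row, hence at most three. *)
exists [set (i, s i) | i in [set i | nonlead le v i]].
  by rewrite -[X in (_ <= X)%N]card_ord; apply: leq_trans (leq_imset_card _ _) (max_card _).
apply: sagbi_basis_of_gen => // [p|f /(minor_alg_comp s)[P ->] nz].
  exact: minors_adjoin_sub.
move: nz; rewrite -defX => nz.
have [a la] := lead_cof_alg leP v_inj diag_min ld d0 nz.
rewrite (in_monE leP la); apply: (sagbi_mon_gen leP v_inj) => [k l m|i nli].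
  rewrite defX; have [p p_minor [->|->] lp] := cofm_minor s k l.
    by exists p; split; [left|apply: lead_neq0 lp|rewrite (in_monE leP lp)].
  have {}lp : lead le p m by rewrite -[p]opprK; apply: leadN.
  by exists p; split; [left|apply: lead_neq0 lp|rewrite (in_monE leP lp)].
have lz : lead le (X i (s i) * \det X) (U_(v i i) + d)%MM.
  have -> : X i (s i) = 'X_(v i i) by rewrite mxE.
  apply: (leadM leP (leadX leP K _)); move: ld; rewrite defX det_col_perm.
  by case: (odd_perm s); rewrite ?mul1r // mulN1r => /(@leadN _ le); rewrite opprK.
exists (X i (s i) * \det X); split; last by rewrite (in_monE leP lz).
  by right; exists (i, s i) => //; apply/imsetP; exists i; rewrite ?inE.
exact: lead_neq0 lz.
Qed.

End TwoMinors.

Theorem theorem8p1 (K : fieldType) :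
  universal_sagbi_basis (minor_alg K 2 3 3) (minors_adjoin K [set: 'I_3 * 'I_3]) /\
  (forall le : rel 'X_{1..3 * 3}, monomial_order le ->
    exists2 E : {set 'I_3 * 'I_3},
      (#|E| <= 3)%N & sagbi_basis le (minor_alg K 2 3 3) (minors_adjoin K E)).
Proof.
split=> [le leP|]; last exact: sagbi_two_minors.
have [E _] := sagbi_two_minors K leP.
apply: sagbi_basis_mono => // [p [|[e _ ->]]|p]; [by left| |exact: minors_adjoin_sub].
by right; exists e; rewrite ?inE.
Qed.
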